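(* Let $\lambda>-1$, $t\in\mathbb{R}$ and let $m\ge2$ be an integer. Let $\beta_n(t;\lambda)$ be the recurrence coefficients associated with the generalised higher order Freud weight $\omega(x;t,\lambda)=|x|^{2\lambda+1}\exp(tx^2-x^{2m})$, $x\in\mathbb{R}$. Then $$\lim_{n\to\infty}\frac{\beta_n(t;\lambda)}{n^{1/m}}=\frac14\left(\frac{(m-1)!}{(\tfrac12)_m}\right)^{1/m}.$$
   Context: The monic polynomials $P_n$ orthogonal with respect to the even weight $\omega(x;t,\lambda)$ satisfy $P_{n+1}(x)=xP_n(x)-\beta_n(t;\lambda)P_{n-1}(x)$ with $P_{-1}=0$, $P_0=1$, which defines $\beta_n(t;\lambda)>0$ for $n\ge1$. $(a)_m=a(a+1)\cdots(a+m-1)$ is the Pochhammer symbol. *)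

(* Defs.v *)
From HB Require Import structures.
From mathcomp Require Import all_boot all_order all_algebra.
From mathcomp Require Import all_classical all_reals all_analysis.

Set Implicit Arguments.
Unset Strict Implicit.
Unset Printing Implicit Defensive.

Import Order.TTheory GRing.Theory Num.Theory.
Import numFieldNormedType.Exports.

Local Open Scope classical_set_scope.
Local Open Scope ring_scope.

(* Since 0 `^ a = 0 for a != 0, the value at x = 0 is 0 when 2 * lambda + 1 < 0,
   where the classical expression is +oo; the point 0 is Lebesgue-negligible. *)
Definition freud_weight (R : realType) (m : nat) (t lambda : R) (x : R) : R :=
  `|x| `^ (2 * lambda + 1) * expR (t * x ^+ 2 - x ^+ (2 * m)).

Definition pochhammer (R : realType) (a : R) (m : nat) : R :=
  \prod_(i < m) (a + i%:R).

(* Orthogonality is stated with the extended-real integral, so that a divergent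
   integral cannot pass for a zero one. *)
Definition monic_orthogonal (R : realType) (w : R -> R) (P : nat -> {poly R})
    : Prop :=
  (forall n, P n \is monic /\ size (P n) = n.+1) /\
  exists2 h : nat -> R, (forall n, 0 < h n) &
    forall i j, (\int[@lebesgue_measure R]_(x in [set: R])
                   ((P i).[x] * (P j).[x] * w x)%:E
                 = (if i == j then h i else 0)%:E)%E.

(* The polynomial P_(n-1), with the convention P_(-1) = 0. *)
Definition prev_poly (R : realType) (P : nat -> {poly R}) (n : nat) : {poly R} :=
  if n is k.+1 then P k else 0.

(* beta 0 multiplies P_(-1) = 0 and is therefore unconstrained; for n >= 1,
   beta n is determined by P, as P (n - 1) is nonzero. *)
Definition recurrence_coefficients (R : realType) (w : R -> R) (beta : nat -> R)
    : Prop :=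
  exists P : nat -> {poly R},
    [/\ monic_orthogonal w P,
        P 0%N = 1 &
        forall n, P n.+1 = 'X * P n - beta n *: prev_poly P n].

(* Main.v *)
Require Import Defs.
From HB Require Import structures.
From mathcomp Require Import all_boot all_order all_algebra.
From mathcomp Require Import all_classical all_reals all_analysis.
From mathcomp Require Import measurable_realfun.
From mathcomp Require Import ring lra zify.

Set Implicit Arguments.
Unset Strict Implicit.
Unset Printing Implicit Defensive.

Import Order.TTheory GRing.Theory Num.Theory.
Import numFieldNormedType.Exports.

Local Open Scope classical_set_scope.
Local Open Scope ring_scope.

(** Write rho = 2 lambda + 1 and let L be the tridiagonal matrix of
    multiplication by x in the basis P_n: ones above the diagonal, beta_n below.

    Integrating the derivative of P_n P_(n-1) w gives the string (Freud)
    equation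
      n + rho [n odd] + 2 t beta_n = 2m beta_n (L^(2m-1))_(n-1,n),
    whose right-hand side is a sum over closed walks of length 2m, hence a
    polynomial in beta_(n-m+1), ..., beta_(n+m-1) with nonnegative coefficients,
    homogeneous of degree m ([freud_string_equation]).  It contains beta_n^m,
    so beta_n = O(n^(1/m)).  After division by N^(1/m), the coefficients with
    index near N thus form a bounded positive sequence x which almost solves the
    equation with constant right-hand side 1; the constant sequence c solves it
    exactly as soon as 2m binom(2m-1, m-1) c^m = 1, and this c is the announced
    limit.  What has to be shown is that x is close to c at N.

    The right-hand side is beta_n times the derivative in beta_n of tr L^(2m), a
    function that is convex in the variables log beta_n, being a sum of
    exponentials of linear forms.  Its gradient is therefore monotone.  In
    finite form ([freud_sum_monotone]): for two weights x, y of finite support,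
      sum_n (x_n^m - y_n^m) (log x_n^m - log y_n^m)
        <= 2m sum_n (log x_n - log y_n) (F_n(x) - F_n(y)),
    F_n(x) = x_n (L^(2m-1))_(n-1,n), because each closed walk contributes
    (X - Y)(log X - log Y) >= 0, with X and Y its two weights, and the left-hand
    side keeps only the walks n -> n-1 -> n -> ... .

    Apply this to x and c cut off outside a window around N.  Away from the ends
    of the window the right-hand side is small by the string equation, so, up to
    a small error and a constant factor, the sum of (x_n - c)^2 over the window
    is bounded by the sum of |x_n - c| over two blocks of fixed size at the ends.  If |x_N - c| stayed above tau, each
    enlargement of the window by one block would add a fixed amount to the sum
    of squares, which however is bounded uniformly in the window
    ([rigidity]). *)

(** * Weighted walks and the right-hand side of the string equation *)

Section Walks.
Variable R : realType.
Implicit Types x y : nat -> R.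

(** The entry (i, j) of the k-th power of the semi-infinite Jacobi matrix with
    ones above the diagonal and x below it, as a sum over walks on the
    nonnegative integers: a step down from i has weight x i, a step up has
    weight 1. *)
Fixpoint walk x k i j : R :=
  if k is k'.+1 then
    walk x k' i.+1 j + (if i is i'.+1 then x i * walk x k' i' j else 0)
  else (i == j)%:R.

(** The closed walks of length 2m whose first step goes from n down to n.-1.  By
    cyclicity this is x_n d/dx_n (tr L^(2m)) divided by 2m, for L the Jacobi
    matrix of x. *)
Definition freud_sum x m n : R := x n * walk x m.*2.-1 n.-1 n.

Lemma eq_walk_pos (x y : nat -> R) k i j :
  (forall n, x n.+1 = y n.+1) -> walk x k i j = walk y k i j.
Proof.
by move=> xy; elim: k i => [|k IH] [|i] //=; rewrite ?xy !IH.
Qed.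

Lemma walk_ge0 x k i j : (forall n, 0 <= x n) -> 0 <= walk x k i j.
Proof.
move=> x0; elim: k i => [|k IH] i /=; first by rewrite ler0n.
by rewrite addr_ge0 //; case: i => // i; rewrite mulr_ge0.
Qed.

Lemma le_walk x y k i j : (forall n, 0 <= x n <= y n) ->
  walk x k i j <= walk y k i j.
Proof.
move=> xy; have x0 n : 0 <= x n by have /andP[] := xy n.
elim: k i => [|k IH] i //=; rewrite lerD //; case: i => // i.
by rewrite ler_pM ?walk_ge0 //; have /andP[] := xy i.+1.
Qed.

Lemma eq_walk x y k i j :
  (forall n, (n < i + k)%N -> (i < n + k)%N -> x n = y n) ->
  walk x k i j = walk y k i j.
Proof.
elim: k i => [|k IH] i xy //=.
rewrite (IH i.+1) => [|n ni nk]; last by apply: xy; lia.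
congr (_ + _); case: i xy => // i xy; rewrite xy; [|lia..]; congr (_ * _).
by apply: IH => n ni nk; apply: xy; lia.
Qed.

Lemma walk_far x k i j : (i + k < j)%N -> walk x k i j = 0.
Proof.
elim: k i => [|k IH] i h /=; first by case: eqP => // ij; lia.
rewrite IH ?add0r; last by lia.
by case: i h => // i h; rewrite IH ?mulr0 //; lia.
Qed.

(** The number d of steps down is determined by the end points and the length,
    so the sum is homogeneous of degree d. *)
Lemma walk_scale s x k i j d : (d.*2 + j = i + k)%N ->
  walk (fun n => s * x n) k i j = s ^+ d * walk x k i j.
Proof.
elim: k i d => [|k IH] i d h /=.
  case: eqP => [ij|_]; last by rewrite mulr0.
  by rewrite (_ : d = 0%N) ?expr0 ?mul1r //; lia.
rewrite (IH i.+1 d) ?mulrDr; last by lia.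
congr (_ + _); case: i h => [|i] h; first by rewrite mulr0.
case: d h => [|d] h; first by rewrite !walk_far ?mulr0 //; lia.
rewrite (IH i d) ?exprS; last by lia.
by rewrite mulrACA.
Qed.

(** Starting at height at least k, a walk of length k never meets the barrier at
    0, and all the choices of its d steps down are allowed. *)
Lemma walk1_binomial k i j d : (d.*2 + j = i + k)%N -> (k <= i)%N ->
  walk (fun=> 1) k i j = 'C(k, d)%:R :> R.
Proof.
elim: k i d => [|k IH] i d h ki /=.
  case: eqP => ij; first by rewrite (_ : d = 0%N) ?bin0 //; lia.
  by rewrite bin0n eqn0Ngt (_ : (0 < d)%N) //; lia.
rewrite (IH i.+1 d); [|lia..].
case: i h ki => // i h ki; case: d h => [|d] h.
  by rewrite walk_far ?mulr0 ?addr0 ?bin0 //; lia.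
by rewrite (IH i d) ?binS ?mul1r -?natrD //; lia.
Qed.

Lemma walk_const_le (B : R) k i j : 0 <= B -> walk (fun=> B) k i j <= (1 + B) ^+ k.
Proof.
move=> B0; have B1 : 0 <= 1 + B by rewrite addr_ge0.
elim: k i => [|k IH] i /=; first by rewrite expr0; case: eqP; rewrite ?ler01.
rewrite exprS mulrDl mul1r lerD // ; case: i => [|i].
  by rewrite mulr_ge0 ?exprn_ge0.
by rewrite ler_wpM2l.
Qed.

Lemma walk_oscillation x k n : (forall n, 0 <= x n) -> (0 < n)%N ->
  x n ^+ k <= walk x k.*2 n n.
Proof.
move=> x0; case: n => // n _; elim: k => [|k IH]; first by rewrite /= eqxx.
rewrite doubleS exprS /=; apply: le_trans (ler_wpM2l (x0 _) IH) _.
rewrite mulrDr addrA -[leLHS]addr0 lerD //; last first.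
  by rewrite mulr_ge0 //; case: (n) => // p; rewrite mulr_ge0 ?walk_ge0.
rewrite -[leLHS]add0r lerD // addr_ge0 ?walk_ge0 // mulr_ge0 ?walk_ge0 //.
Qed.

Lemma freud_sum_ge0 x m n : (forall n, 0 <= x n) -> 0 <= freud_sum x m n.
Proof. by move=> x0; rewrite mulr_ge0 ?walk_ge0. Qed.

Lemma freud_sum_bound B x m n : (forall n, 0 <= x n <= B) ->
  freud_sum x m n <= x n * (1 + B) ^+ m.*2.-1.
Proof.
move=> xB; have x0 i : 0 <= x i by have /andP[] := xB i.
have B0 : 0 <= B by have /andP[h1] := xB 0%N; exact: le_trans.
rewrite ler_wpM2l //; apply: le_trans (walk_const_le _ _ _ B0).
exact: le_walk.
Qed.

(** The walk that oscillates between n and n.-1 has weight x_n^m; it is what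
    makes the string equation an upper bound for the coefficients. *)
Lemma exp_le_freud_sum x m n : (forall n, 0 <= x n) -> (0 < n)%N -> (0 < m)%N ->
  x n ^+ m <= freud_sum x m n.
Proof.
move=> x0 n0; case: m => // m _; rewrite /freud_sum doubleS /= exprS ler_wpM2l //.
case: n n0 => // n n0 /=; apply: le_trans (walk_oscillation m x0 n0) _.
rewrite lerDl; case: (n) => // p; rewrite mulr_ge0 ?walk_ge0 //.
Qed.

(** Locality: walks of length 2m stay within distance 2m, so weights may be cut
    off outside a window without changing the equation in its interior. *)
Lemma eq_freud_sum x y m n : (0 < n)%N ->
  (forall i, (i < n + m.*2)%N -> (n < i + m.*2)%N -> x i = y i) ->
  freud_sum x m n = freud_sum y m n.
Proof.
move=> n0 xy; rewrite /freud_sum; have [->|m0] := posnP m.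
  by rewrite /= ltn_eqF ?mulr0 //; lia.
by rewrite xy; [|lia..]; congr (_ * _); apply: eq_walk => i h1 h2; apply: xy; lia.
Qed.

Lemma freud_sum_scale s x m n : (0 < n)%N -> (0 < m)%N ->
  freud_sum (fun n => s * x n) m n = s ^+ m * freud_sum x m n.
Proof.
move=> n0 m0; rewrite /freud_sum.
have h : (m.-1.*2 + n = n.-1 + m.*2.-1)%N by lia.
by rewrite (walk_scale s x h) mulrACA -exprS prednK.
Qed.

Lemma freud_sum_const (c : R) m n : (m.*2 <= n)%N -> (0 < m)%N ->
  freud_sum (fun=> c) m n = c ^+ m * 'C(m.*2.-1, m.-1)%:R :> R.
Proof.
move=> mn m0; have -> : (fun=> c) = (fun n : nat => c * (fun=> 1) n) :> (nat -> R).
  by apply/funext => i; rewrite mulr1.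
rewrite freud_sum_scale //; last by lia.
by rewrite /freud_sum mul1r (walk1_binomial (d := m.-1)) //; lia.
Qed.

End Walks.

(** * Log-convexity of the trace of a matrix power *)

Section LogConvexity.
Variables (R : realType) (n : nat).
Implicit Types (X Y H : 'M[R]_n.+1) (a b : 'I_n.+1) (u v : R).

Definition log_gap (u v : R) : R := (u - v) * (ln u - ln v).

Lemma log_gap_ge0 u v : 0 < u -> 0 < v -> 0 <= log_gap u v.
Proof.
move=> u0 v0; rewrite /log_gap; case: (leP u v) => uv.
  by rewrite mulr_le0 ?subr_le0 // ler_ln.
by rewrite mulr_ge0 ?subr_ge0 // ?ler_ln // ltW.
Qed.

Definition hadamard X H : 'M[R]_n.+1 := \matrix_(a, b) (X a b * H a b).

Definition log_ratio X Y : 'M[R]_n.+1 := \matrix_(a, b) (ln (X a b) - ln (Y a b)).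

(** The sum of log_gap (u * X^g) (v * Y^g) over the walks g of length k from a
    to b, X^g being the product of the entries of X along g.  The prefactors u
    and v carry the weight of the part of the walk already traversed, which lets
    the recursion avoid any explicit set of walks. *)
Fixpoint walk_gap X Y k u v a b : R :=
  if k is k'.+1 then
    \sum_(c | X a c != 0) walk_gap X Y k' (u * X a c) (v * Y a c) c b
  else if a == b then log_gap u v else 0.

(** The derivative of X^k when the logarithms of the entries of X move with
    velocity H, i.e. when X moves with velocity hadamard X H. *)
Fixpoint exp_derivative X H k : 'M[R]_n.+1 :=
  if k is k'.+1 then hadamard X H * X ^+ k' + X * exp_derivative X H k' else 0.

(** By cyclicity of the trace, the k places where the product rule may
    differentiate all contribute the same amount.  The factor X ^+ j is there
    for the induction. *)
Lemma mxtrace_exp_derivative X H k j :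
  \tr (X ^+ j * exp_derivative X H k)
    = k%:R * \tr (hadamard X H * X ^+ (k + j).-1).
Proof.
elim: k j => [|k IH] j /=; first by rewrite mulr0 mxtrace0 mul0r.
rewrite mulrDr mxtraceD (mulrA _ X) -exprSr IH -!mulmxE mxtrace_mulC mulmxE -mulrA -exprD.
rewrite addnS /= [(k + j)%N]addnC -[k.+1]addn1 natrD mulrDl mul1r.
by rewrite addrC.
Qed.

Section SameSupport.
Variables X Y : 'M[R]_n.+1.
Hypothesis X_ge0 : forall a b, 0 <= X a b.
Hypothesis Y_ge0 : forall a b, 0 <= Y a b.
Hypothesis support : forall a b, (X a b == 0) = (Y a b == 0).

Lemma walk_gap_ge0 k u v a b : 0 < u -> 0 < v -> 0 <= walk_gap X Y k u v a b.
Proof.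
elim: k u v a => [|k IH] u v a u0 v0 /=.
  by case: eqP => // _; exact: log_gap_ge0.
apply: sumr_ge0 => c Xac; apply: IH; rewrite mulr_gt0 // lt_def.
  by rewrite Xac X_ge0.
by rewrite -support Xac Y_ge0.
Qed.

(** Since log X^g - log Y^g is the sum of log_ratio X Y along g, summing
    (X^g - Y^g)(log X^g - log Y^g) over walks produces the two derivatives of
    the power in the direction log_ratio X Y. *)
Lemma walk_gapE k u v a b : 0 < u -> 0 < v ->
  walk_gap X Y k u v a b =
    (ln u - ln v) * (u * (X ^+ k) a b - v * (Y ^+ k) a b)
    + u * exp_derivative X (log_ratio X Y) k a b
    - v * exp_derivative Y (log_ratio X Y) k a b.
Proof.
elim: k u v a => [|k IH] u v a u0 v0 /=.
  rewrite !expr0 !mxE; case: eqP => _; rewrite /log_gap /=; ring.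
rewrite !exprS !mxE !mulr_sumr -!big_split /= !mulr_sumr -!sumrN -!big_split /=.
rewrite mulr_sumr -!big_split /= big_mkcond /=; apply: eq_bigr => c _.
rewrite !mxE; case: eqP => [Xac | /eqP Xac] /=.
  have /eqP Yac : Y a c == 0 by rewrite -support Xac.
  rewrite Xac Yac; ring.
have Xac0 : 0 < X a c by rewrite lt_def Xac X_ge0.
have Yac0 : 0 < Y a c by rewrite lt_def -support Xac Y_ge0.
rewrite IH ?mulr_gt0 // !lnM ?posrE //; ring.
Qed.

Lemma sum_walk_gap k :
  \sum_a walk_gap X Y k 1 1 a a = k%:R *
   (\tr (hadamard X (log_ratio X Y) * X ^+ k.-1)
    - \tr (hadamard Y (log_ratio X Y) * Y ^+ k.-1)).
Proof.
have E Z H : \tr (exp_derivative Z H k) = k%:R * \tr (hadamard Z H * Z ^+ k.-1).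
  by have := mxtrace_exp_derivative Z H k 0; rewrite expr0 mul1r addn0.
rewrite mulrBr -!E /mxtrace -sumrN -big_split /=; apply: eq_bigr => a _.
by rewrite walk_gapE // subrr mul0r add0r !mul1r.
Qed.

Lemma walk_gap_step k u v a b c : 0 < u -> 0 < v -> X a c != 0 ->
  walk_gap X Y k (u * X a c) (v * Y a c) c b <= walk_gap X Y k.+1 u v a b.
Proof.
move=> u0 v0 Xac /=; rewrite (bigD1 c) //= lerDl.
apply: sumr_ge0 => d /andP [Xad _]; apply: walk_gap_ge0; rewrite mulr_gt0 // lt_def.
  by rewrite Xad X_ge0.
by rewrite -support Xad Y_ge0.
Qed.

(** All walks contribute nonnegatively, so one may keep only the walk
    a -> c -> a -> ... -> a. *)
Lemma log_gap_oscillation k u v a c : 0 < u -> 0 < v ->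
  X a c != 0 -> X c a != 0 ->
  log_gap (u * (X a c * X c a) ^+ k) (v * (Y a c * Y c a) ^+ k)
    <= walk_gap X Y k.*2 u v a a.
Proof.
move=> u0 v0 Xac Xca.
have Xac0 : 0 < X a c by rewrite lt_def Xac X_ge0.
have Yac0 : 0 < Y a c by rewrite lt_def -support Xac Y_ge0.
have Xca0 : 0 < X c a by rewrite lt_def Xca X_ge0.
have Yca0 : 0 < Y c a by rewrite lt_def -support Xca Y_ge0.
elim: k u v u0 v0 => [|k IH] u v u0 v0; first by rewrite !expr0 !mulr1 /= eqxx.
rewrite doubleS; apply: le_trans (walk_gap_step _ _ u0 v0 Xac).
apply: le_trans (walk_gap_step _ _ _ _ Xca); rewrite ?mulr_gt0 //.
by rewrite -!(mulrA _ _ (_ c a)) !exprS !(mulrA _ (_ * _)) IH // !mulr_gt0.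
Qed.

End SameSupport.
End LogConvexity.

Section JacobiMatrices.
Variable R : realType.
Implicit Types x y : nat -> R.

Definition jacobi n x : 'M[R]_n.+1 :=
  \matrix_(a, b) (if b == a.+1 :> nat then 1 else
                  if a == b.+1 :> nat then x a else 0).

(** There is no way down from S when the weights vanish from there on. *)
Lemma walk_trapped x S k i j : (forall n, (S <= n)%N -> x n = 0) ->
  (S <= i)%N -> (j < S)%N -> walk x k i j = 0.
Proof.
move=> xS; elim: k i => [|k IH] i Si jS /=.
  by case: eqP => // ij; move: Si; rewrite ij leqNgt jS.
rewrite IH // ?(leq_trans Si) // add0r; case: i Si => // i Si.
by rewrite xS // mul0r.
Qed.

(** For weights supported in [0, n] the truncation of the Jacobi matrix to size
    n.+1 loses nothing. *)
Lemma jacobi_expE n x k (a b : 'I_n.+1) : (forall i, (n < i)%N -> x i = 0) ->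
  (jacobi n x ^+ k) a b = walk x k a b.
Proof.
move=> xn; elim: k a => [|k IH] a; first by rewrite expr0 mxE.
rewrite exprS mxE.
transitivity (\sum_(c < n.+1) ((if c == a.+1 :> nat then walk x k c b else 0)
   + (if c.+1 == a :> nat then x a * walk x k c b else 0))).
  apply: eq_bigr => c _; rewrite mxE IH [in X in _ = _ + X]eq_sym.
  case: eqP => [->|_]; last by case: eqP => // _; rewrite ?add0r ?mul0r.
  by rewrite mul1r (_ : (_ == _) = false) ?addr0 //; lia.
rewrite big_split /= -!big_mkcond /=.
rewrite (big_ord1_eq _ (fun c => walk x k c b)); congr (_ + _).
  by case: ltnP => // h; rewrite (walk_trapped (S := n.+1)).
case: a => [[|a]] /= ha; first by rewrite big1 // => c; rewrite eqn0Ngt.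
rewrite (eq_bigl (fun c : 'I__ => c == a :> nat)) => [|c]; last by rewrite eqSS.
by rewrite (big_ord1_eq _ (fun c => x a.+1 * walk x k c b)) ltnW.
Qed.

Lemma mxtrace_hadamard_jacobi n x y z k :
  (forall i, (n < i)%N -> x i = 0) ->
  \tr (hadamard (jacobi n x) (log_ratio (jacobi n z) (jacobi n y))
        * jacobi n x ^+ k)
    = \sum_(1 <= i < n.+1) (ln (z i) - ln (y i)) * (x i * walk x k i.-1 i).
Proof.
move=> xn; rewrite [RHS]big_add1 /=.
rewrite /mxtrace big_ord_recl mxE big1 => [|c _]; last first.
  rewrite !mxE /=; case: eqP => _; rewrite ?subrr ?mulr0 ?mul0r //.
rewrite add0r big_mkord; apply: eq_bigr => i _.
rewrite mxE (bigD1 (widen_ord (leqnSn n) i)) //= big1 => [|c cw].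
  rewrite !mxE jacobi_expE // /= eqxx (_ : (_ == _) = false) /=; last by rewrite /bump /=; lia.
  rewrite addr0 /bump /= add1n; ring.
rewrite !mxE /=; case: eqP => _; first by rewrite subrr mulr0 mul0r.
case: eqP => h; last by rewrite !mul0r.
case/negP: cw; apply/eqP/val_inj => /=; move: h; rewrite /bump /=; lia.
Qed.

(** Monotonicity of the gradient of the log-convex function tr L^(2m), with the
    strictness supplied by the oscillating walks.  The factor 2m comes from
    cyclicity of the trace. *)
Lemma freud_sum_monotone m S x y :
  (forall n, 0 <= x n) -> (forall n, 0 <= y n) ->
  (forall n, (x n == 0) = (y n == 0)) ->
  (forall n, (S < n)%N -> x n = 0) ->
  \sum_(1 <= n < S.+1) log_gap (x n ^+ m) (y n ^+ m)
   <= m.*2%:R * \sum_(1 <= n < S.+1)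
       (ln (x n) - ln (y n)) * (freud_sum x m n - freud_sum y m n).
Proof.
move=> x0 y0 supp xS.
have yS n : (S < n)%N -> y n = 0 by move=> /xS /eqP; rewrite supp => /eqP.
have J0 z a b : (forall n, 0 <= z n) -> 0 <= jacobi S z a b.
  by move=> z0; rewrite mxE; case: ifP => // _; case: ifP.
have Js a b : (jacobi S x a b == 0) = (jacobi S y a b == 0).
  by rewrite !mxE; case: ifP => // _; case: ifP => // _; rewrite eqxx.
have := sum_walk_gap (X := jacobi S x) (Y := jacobi S y)
  (fun a b => J0 x a b x0) (fun a b => J0 y a b y0) Js m.*2.
rewrite !mxtrace_hadamard_jacobi // -sumrN -big_split /=.
rewrite [in X in _ = _ * X](eq_bigr (fun n => (ln (x n) - ln (y n)) *
   (freud_sum x m n - freud_sum y m n))) => [<-|n _]; last by rewrite /freud_sum; ring.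
rewrite big_add1 big_mkord big_ord_recl.
rewrite -[leLHS]add0r lerD //.
  by apply: walk_gap_ge0 => // a b; exact: J0.
apply: ler_sum => i _.
have [xi0|xi0] := eqVneq (x i.+1) 0.
  have /eqP yi0 : y i.+1 == 0 by rewrite -supp xi0.
  rewrite xi0 yi0 /log_gap subrr mul0r.
  by apply: walk_gap_ge0 => // a b; exact: J0.
set a := lift ord0 i; pose c := widen_ord (leqnSn S) i.
have ac z : jacobi S z a c = z i.+1.
  by rewrite mxE /= eqxx (_ : (_ == _) = false) //; rewrite /bump /=; lia.
have ca z : jacobi S z c a = 1.
  by rewrite mxE /= /bump /= eqxx.
have := @log_gap_oscillation _ _ _ _ (fun a b => J0 x a b x0) (fun a b => J0 y a b y0) Js
   m 1 1 a c ltr01 ltr01.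
rewrite !ac !ca !mul1r !mulr1; apply => //; exact: oner_neq0.
Qed.

End JacobiMatrices.

(** * Rigidity of approximate solutions of the string equation *)

Section Estimates.
Variable R : realType.

(** For v <= u, ln (v / u) <= v / u - 1 bounds ln u - ln v below by (u - v) / u. *)
Lemma ln_diff_ge (B u v : R) : 0 < u <= B -> 0 < v <= B ->
  (u - v) ^+ 2 / B <= (u - v) * (ln u - ln v).
Proof.
wlog uv : u v / v <= u => [H uB vB|].
  have [uv|/ltW uv] := leP v u; first exact: H.
  rewrite -sqrrN opprB -(opprB v u) -(opprB (ln v)) mulrNN; exact: H.
move=> /andP[u0 uB] /andP[v0 vB]; have B0 : 0 < B by exact: lt_le_trans uB.
rewrite expr2 -mulrA ler_wpM2l ?subr_ge0 //.
apply: (@le_trans _ _ ((u - v) / u)).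
  by rewrite ler_wpM2l ?subr_ge0 // lef_pV2 ?posrE.
have := le_ln1Dx (x := v / u - 1).
rewrite addrCA subrr addr0 ln_div ?posrE // => /(_ _).
have -> : (u - v) / u = 1 - v / u by field; rewrite gt_eqF.
have : 0 < v / u by rewrite divr_gt0.
move=> h1 h2; have := h2; lra.
Qed.

Lemma ln_diff_le (L u v : R) : 0 < L -> L <= u -> L <= v ->
  `|ln u - ln v| <= `|u - v| / L.
Proof.
wlog uv : u v / v <= u => [H L0 Lu Lv|].
  have [uv|/ltW uv] := leP v u; first exact: H.
  by rewrite distrC (distrC u); exact: H.
move=> L0 Lu Lv; have u0 : 0 < u by exact: lt_le_trans Lu.
have v0 : 0 < v by exact: lt_le_trans Lv.
rewrite !ger0_norm ?subr_ge0 // ?ler_ln //.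
apply: (@le_trans _ _ ((u - v) / v)); last first.
  by rewrite ler_wpM2l ?subr_ge0 // lef_pV2 ?posrE.
have := le_ln1Dx (x := u / v - 1).
rewrite addrCA subrr addr0 ln_div ?posrE // => /(_ _).
have -> : (u - v) / v = u / v - 1 by field; rewrite gt_eqF.
have : 0 < u / v by rewrite divr_gt0.
move=> h1 h2; have := h2; lra.
Qed.

Lemma pow_diff_ge m (u v : R) : 0 <= u -> 0 <= v -> (0 < m)%N ->
  v ^+ m.-1 * `|u - v| <= `|u ^+ m - v ^+ m|.
Proof.
move=> u0 v0; case: m => // m _ /=.
rewrite subrXX normrM mulrC ler_wpM2l // ger0_norm.
  rewrite big_ord_recr /= subnn expr0 mul1r lerDr.
  by apply: sumr_ge0 => i _; rewrite mulr_ge0 ?exprn_ge0.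
by apply: sumr_ge0 => i _; rewrite mulr_ge0 ?exprn_ge0.
Qed.
End Estimates.

Section Rigidity.
Variable R : realType.
Implicit Types x y : nat -> R.

Definition window N r n := (N <= n + r)%N && (n <= N + r)%N.

Lemma window_sub N r1 r2 n : (r1 <= r2)%N -> window N r1 n -> window N r2 n.
Proof. by rewrite /window; lia. Qed.

Lemma sum_interval_le S a b :
  \sum_(1 <= n < S | (a <= n < b)%N) (1 : R) <= (b - a)%:R.
Proof.
have -> : \sum_(1 <= n < S | (a <= n < b)%N) (1 : R)
    = (\sum_(1 <= n < S | (a <= n < b)%N) 1)%:R by rewrite natr_sum.
rewrite ler_nat.
suff : (\sum_(1 <= n < S | a <= n < b) 1 <= minn S b - a)%N by lia.
elim: S => [|[|S] IH]; [by rewrite big_geq..|].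
rewrite big_mkcond big_nat_recr //= -big_mkcond /=.
by case: ifP => h; lia.
Qed.

Lemma sum_window_le S N r : \sum_(1 <= n < S | window N r n) (1 : R) <= (r.*2.+1)%:R.
Proof.
apply: le_trans (_ : \sum_(1 <= n < S | (N - r <= n < (N + r).+1)%N) (1 : R) <= _).
  rewrite le_eqVlt; apply/orP; left; apply/eqP; apply: eq_bigl => n.
  rewrite /window; lia.
by apply: le_trans (sum_interval_le _ _ _) _; rewrite ler_nat; lia.
Qed.

Lemma sum_shell_le S N r w :
  \sum_(1 <= n < S | window N (r + w) n && ~~ window N r n) (1 : R) <= (w.*2)%:R.
Proof.
pose I1 n := (N - (r + w) <= n < N - r)%N.
pose I2 n := (N + r.+1 <= n < N + (r + w).+1)%N.
apply: le_trans (_ : \sum_(1 <= n < S | I1 n) (1 : R)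
                    + \sum_(1 <= n < S | I2 n) (1 : R) <= _).
  rewrite [leLHS]big_mkcond [X in _ <= X + _]big_mkcond.
  rewrite [X in _ <= _ + X]big_mkcond -big_split /=; apply: ler_sum => n _.
  have : window N (r + w) n && ~~ window N r n -> I1 n || I2 n.
    by rewrite /window /I1 /I2; lia.
  by case: (_ && _) => [/(_ isT)|_]; case: (I1 n); case: (I2 n) => //= _; lra.
apply: le_trans (lerD (sum_interval_le _ _ _) (sum_interval_le _ _ _)) _.
rewrite -natrD ler_nat; lia.
Qed.

Lemma sum_split_window S N r w (F : nat -> R) :
  \sum_(1 <= n < S | window N (r + w) n) F n =
  \sum_(1 <= n < S | window N r n) F n +
  \sum_(1 <= n < S | window N (r + w) n && ~~ window N r n) F n.
Proof.
rewrite (bigID (window N r)) /=; congr (_ + _); apply: eq_bigl => n.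
by rewrite /window; lia.
Qed.

Variables (m : nat) (L c B : R).
Hypotheses (m0 : (0 < m)%N) (L0 : 0 < L) (Lc : L <= c) (cB : c <= B).

Let c0 : 0 < c. Proof. exact: lt_le_trans Lc. Qed.
Let B0 : 0 < B. Proof. exact: lt_le_trans cB. Qed.
Let A : R := (c ^+ m.-1) ^+ 2 / B ^+ m.
Let F : R := B * (1 + B) ^+ m.*2.-1.
Let w := m.*2.

Let A0 : 0 < A. Proof. by rewrite divr_gt0 ?exprn_gt0. Qed.
Let F0 : 0 < F. Proof. by rewrite mulr_gt0 ?exprn_gt0 ?addr_gt0. Qed.

Lemma log_gap_pow_ge u : L <= u <= B ->
  A * (u - c) ^+ 2 <= log_gap (u ^+ m) (c ^+ m).
Proof.
move=> /andP[Lu uB]; have u0 : 0 < u by exact: lt_le_trans Lu.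
apply: le_trans (ln_diff_ge (B := B ^+ m) _ _); last 2 first.
- by rewrite exprn_gt0 //= lerXn2r // ?nnegrE ltW.
- by rewrite exprn_gt0 //= lerXn2r // ?nnegrE ltW.
rewrite /A mulrAC ler_wpM2r //; first by rewrite invr_ge0 exprn_ge0 // ltW.
have := pow_diff_ge (ltW u0) (ltW c0) m0.
rewrite -exprMn => h; rewrite -[leRHS]real_normK ?num_real //.
rewrite -[leLHS]real_normK ?num_real // normrM (ger0_norm (exprn_ge0 _ (ltW c0))).
by rewrite lerXn2r // nnegrE mulr_ge0 // exprn_ge0 // ltW.
Qed.

(** The monotonicity inequality for x and c, both cut off outside the window of
    radius r + 2m.  In the inner window the cut-off is not felt and the defect
    e is available; in the surrounding shell only the a priori bound F is. *)
Lemma window_inequality N r S x (e : R) :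
  (r + w < N)%N -> (N + (r + w) <= S)%N ->
  (forall n, window N (r + w) n -> L <= x n <= B) ->
  (forall n, window N r n -> `|freud_sum x m n - freud_sum (fun=> c) m n| <= e) ->
  A * \sum_(1 <= n < S.+1 | window N (r + w) n) (x n - c) ^+ 2 <=
  w%:R / L * (e * \sum_(1 <= n < S.+1 | window N r n) `|x n - c|
    + F * \sum_(1 <= n < S.+1 | window N (r + w) n && ~~ window N r n) `|x n - c|).
Proof.
move=> rN NS xB xe.
(* Zero weights outside the window confine all closed walks to it. *)
pose cut z n : R := if window N (r + w) n then z n else 0.
have cut_bd z : (forall n, window N (r + w) n -> L <= z n <= B) ->
    forall n, 0 <= cut z n <= B.
  move=> zB n; rewrite /cut; case: ifP => [/zB /andP[Lz ->]|_]; last by rewrite lexx ltW.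
  by rewrite andbT; apply: le_trans (ltW L0) Lz.
have xb := cut_bd _ xB.
have cb := cut_bd (fun=> c) (fun n _ => introT andP (conj Lc cB)).
have freud_le z n : (forall n, 0 <= z n <= B) -> 0 <= freud_sum z m n <= F.
  move=> zB; have z0 i : 0 <= z i by have /andP[] := zB i.
  rewrite freud_sum_ge0 //=; apply: le_trans (freud_sum_bound _ _ zB) _.
  rewrite /F ler_wpM2r ?exprn_ge0 ?addr_ge0 ?(ltW B0) //.
  by have /andP[] := zB n.
have cut_eq z n : window N r n -> freud_sum (cut z) m n = freud_sum z m n.
  move=> wn; apply: eq_freud_sum => [|i i1 i2]; first by move: wn; rewrite /window; lia.
  by rewrite /cut (_ : window N (r + w) i) //; move: wn; rewrite /window /w; lia.
have supp n : (cut x n == 0) = (cut (fun=> c) n == 0).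
  rewrite /cut; case: ifP => [wn|]; last by rewrite eqxx.
  have /andP[Lx _] := xB n wn.
  by rewrite !gt_eqF // (lt_le_trans L0).
have cut0 n : (S < n)%N -> cut x n = 0.
  by move=> Sn; rewrite /cut (_ : window _ _ _ = false) //; rewrite /window; lia.
have cut_ge0 z : (forall n, 0 <= cut z n <= B) -> forall n, 0 <= cut z n.
  by move=> zb n; have /andP[] := zb n.
have mono := freud_sum_monotone m (cut_ge0 _ xb) (cut_ge0 _ cb) supp cut0.
apply: le_trans (_ : \sum_(1 <= n < S.+1) log_gap (cut x n ^+ m) (cut (fun=> c) n ^+ m) <= _).
  rewrite mulr_sumr big_mkcond; apply: ler_sum => n _; rewrite /cut.
  case: ifP => [wn|_]; first exact/log_gap_pow_ge/xB.
  by rewrite /log_gap subrr mul0r.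
apply: le_trans mono _; rewrite -mulrA ler_wpM2l // mulrDr !mulr_sumr.
rewrite [X in _ <= X + _]big_mkcond [X in _ <= _ + X]big_mkcond -big_split /=.
apply: ler_sum => n _.
have [wn|wn] := boolP (window N (r + w) n); last first.
  rewrite /cut (negPf wn) subrr mul0r /= addr0.
  by rewrite (_ : window N r n = false) //; move: wn; rewrite /window; lia.
have /andP[Lx xB'] := xB n wn.
have lnd : `|ln (cut x n) - ln (cut (fun=> c) n)| <= L^-1 * `|x n - c|.
  by rewrite /cut wn mulrC ln_diff_le.
apply: le_trans (ler_norm _) _; rewrite normrM.
case: ifP => [wr|wr] /=; rewrite ?addr0 ?add0r mulrCA [leRHS]mulrC ler_pM //.
  by rewrite !cut_eq // xe.
have /andP[f0 fF] := freud_le _ n xb; have /andP[g0 gF] := freud_le _ n cb.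
by rewrite ler_norml; lra.
Qed.

(** Apply the window inequality to the radii k w, w = 2m, k < J.  If
    |x N - c| >= tau, its left-hand side is at least q = A tau^2, and e is so
    small that the defect term is at most q / 4.  Hence every shell sum is
    bounded below, and by AM-GM (with the parameter s chosen so that the constant
    part costs another q / 4) every shell adds at least th to the sum T of
    squares.  As T stays below a bound U that does not depend on J, this is
    absurd for J large. *)
Lemma rigidity (tau : R) : 0 < tau -> exists r (e : R), 0 < e /\
  forall N x, (r < N)%N ->
    (forall n, window N r n -> L <= x n <= B) ->
    (forall n, window N r n -> `|freud_sum x m n - freud_sum (fun=> c) m n| <= e) ->
    `|x N - c| < tau.
Proof.
move=> tau0.
have w0 : 0 < w%:R :> R by rewrite ltr0n /w double_gt0.
pose C : R := w%:R / L; have C0 : 0 < C by rewrite divr_gt0.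
pose q := A * tau ^+ 2; have q0 : 0 < q by rewrite mulr_gt0 ?exprn_gt0.
pose s := q / (8%:R * (C * F) * w%:R).
have CF0 : 0 < C * F by rewrite mulr_gt0.
have s0 : 0 < s by apply: divr_gt0 => //; apply: mulr_gt0 => //; apply: mulr_gt0.
have sE : C * F * (2%:R * w%:R * s) = q / 4%:R.
  by rewrite /s; field; rewrite !gt_eqF.
pose th := q * s / (2%:R * (C * F)).
have th0 : 0 < th by apply: divr_gt0; apply: mulr_gt0.
pose U := (q / 4%:R + C * F * (2%:R * w%:R * B)) / (A * th).
have U0 : 0 <= U.
  apply/ltW/divr_gt0; last exact: mulr_gt0.
  apply: addr_gt0; first exact: divr_gt0.
  by apply: mulr_gt0 => //; apply: mulr_gt0 => //; exact: mulr_gt0.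
pose J := (Num.bound U).+1.
have JU : U < J%:R.
  by apply: lt_trans (archi_boundP U0) _; rewrite ltr_nat.
pose M : R := ((J * w).*2.+1)%:R; have M0 : 0 < M by rewrite ltr0n.
pose e := q / 4%:R / (C * B * M).
have e0 : 0 < e by apply: divr_gt0; [exact: divr_gt0 | apply: mulr_gt0 => //; exact: mulr_gt0].
have eE : C * (e * (B * M)) = q / 4%:R.
  by rewrite /e; field; rewrite !gt_eqF.
exists (J * w)%N, e; split => // N x rN xB xe.
rewrite ltNge; apply/negP => dN.
pose S := (N + J * w)%N.
pose T k := \sum_(1 <= n < S.+1 | window N (k * w) n) (x n - c) ^+ 2.
pose sh k := \sum_(1 <= n < S.+1 | window N (k * w + w) n && ~~ window N (k * w) n)
  `|x n - c|.
have kJw k : (k < J)%N -> (k * w + w <= J * w)%N.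
  by move=> kJ; rewrite addnC -mulSn leq_mul2r kJ orbT.
have d_le n : window N (J * w) n -> `|x n - c| <= B.
  move=> /xB /andP[Ln nB]; rewrite ler_norml; have := c0; have := L0; have := cB; lra.
have TS k : T k.+1 = T k + \sum_(1 <= n < S.+1 |
    window N (k * w + w) n && ~~ window N (k * w) n) (x n - c) ^+ 2.
  by rewrite /T mulSn addnC sum_split_window.
have T_ge0 k : 0 <= T k by apply: sumr_ge0 => n _; exact: sqr_ge0.
have ineq k : (k < J)%N -> A * T k.+1 <= q / 4%:R + C * F * sh k.
  move=> kJ; have kw := kJw k kJ.
  have kw' : (k * w <= J * w)%N by exact: leq_trans (leq_addr _ _) kw.
  rewrite /T mulSn addnC.
  apply: le_trans (@window_inequality N (k * w) S x e _ _ _ _) _.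
  - exact: leq_ltn_trans rN.
  - by rewrite /S leq_add2l.
  - by move=> n wn; apply/xB/(window_sub _ wn).
  - by move=> n wn; exact/xe/(window_sub _ wn).
  rewrite -/C mulrDr (mulrA C F) /sh.
  rewrite lerD2r -eE ler_pM2l // ler_pM2l //.
  apply: le_trans (_ : \sum_(1 <= n < S.+1 | window N (k * w) n) B * 1 <= _).
    by apply: ler_sum => n wn; rewrite mulr1; exact/d_le/(window_sub _ wn).
  rewrite -mulr_sumr ler_pM2l //; apply: le_trans (sum_window_le _ _ _) _.
  by rewrite ler_nat ltnS leq_double.
have T_ge k : q <= A * T k.
  have NS : N \in index_iota 1 S.+1.
    by rewrite mem_index_iota (leq_ltn_trans _ rN) //= ltnS leq_addr.
  rewrite /q ler_pM2l // /T big_mkcond (bigD1_seq N) ?iota_uniq //=.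
  rewrite {1}/window !leq_addr /= -[leLHS]addr0 lerD //; last first.
    by apply: sumr_ge0 => n _; case: ifP => // _; exact: sqr_ge0.
  rewrite -[leRHS]real_normK ?num_real // lerXn2r // nnegrE //.
  exact: ltW.
have shell_small k : sh k <= 2%:R * w%:R * s + (T k.+1 - T k) / s.
  rewrite TS addrAC subrr add0r mulr_suml.
  apply: le_trans (_ : \sum_(1 <= n < S.+1 |
      window N (k * w + w) n && ~~ window N (k * w) n) (s * 1 + (x n - c) ^+ 2 / s) <= _).
    apply: ler_sum => n _; rewrite mulr1 -[X in X / s]real_normK ?num_real //.
    set d := `|_|; rewrite -subr_ge0.
    have -> : s + d ^+ 2 / s - d = ((d - s) ^+ 2 + d * s) / s by field; rewrite gt_eqF.
    apply: divr_ge0; last exact: ltW.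
    by apply: addr_ge0; [exact: sqr_ge0 | apply: mulr_ge0; [exact: normr_ge0 | exact: ltW]].
  rewrite big_split /= -mulr_sumr lerD2r mulrC ler_pM2r //.
  apply: le_trans (sum_shell_le _ _ _ _) _.
  by rewrite -natrM ler_nat mul2n.
have grow k : (k < J)%N -> T k + th <= T k.+1.
  move=> kJ; have h1 := ineq k kJ; have h2 := T_ge k.+1.
  have h3 := ler_wpM2l (ltW CF0) (shell_small k).
  rewrite mulrDr sE in h3.
  have h4 : q / 2%:R <= C * F * ((T k.+1 - T k) / s) by lra.
  have CF2 : 0 < 2%:R * (C * F) by exact: mulr_gt0.
  rewrite -lerBrDl /th (ler_pdivrMr _ _ CF2).
  have := ler_wpM2r (ltW s0) h4.
  have -> : C * F * ((T k.+1 - T k) / s) * s = C * F * (T k.+1 - T k).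
    by field; rewrite gt_eqF.
  lra.
have TJ : forall i, (i <= J)%N -> i%:R * th <= T i.
  elim => [|j IH] jJ; first by rewrite mul0r; exact: T_ge0.
  apply: le_trans (grow _ jJ).
  by rewrite -natr1 mulrDl mul1r lerD2r; apply/IH/ltnW.
have sh_le k : (k < J)%N -> sh k <= 2%:R * w%:R * B.
  move=> kJ; apply: le_trans (_ : \sum_(1 <= n < S.+1 |
      window N (k * w + w) n && ~~ window N (k * w) n) B * 1 <= _).
    apply: ler_sum => n /andP[wn _]; rewrite mulr1; apply/d_le/(window_sub _ wn).
    exact: kJw.
  rewrite -mulr_sumr mulrC ler_pM2r //; apply: le_trans (sum_shell_le _ _ _ _) _.
  by rewrite -natrM ler_nat mul2n.
have Ath0 : 0 < A * th by exact: mulr_gt0.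
have : J%:R * th * A <= U * (A * th).
  rewrite /U divfK ?(gt_eqF Ath0) // mulrC.
  apply: le_trans (ler_wpM2l (ltW A0) (TJ J (leqnn _))) _.
  apply: le_trans (ineq _ (ltnSn _)) _.
  by rewrite lerD2l ler_pM2l // sh_le.
by rewrite -mulrA (mulrC th) (ler_pM2r Ath0) leNgt JU.
Qed.
End Rigidity.

Lemma window_near N r w n i :
  window N r n -> (i < n + w)%N -> (n < i + w)%N -> window N (r + w) i.
Proof. by rewrite /window; lia. Qed.

Lemma window_bounds (R : realType) N r w n : (r + w < N)%N -> window N r n ->
  [/\ (w < n)%N, n%:R <= 2 * N%:R :> R & `|n%:R - N%:R| <= r%:R :> R].
Proof.
rewrite /window => rN /andP[h1 h2]; split; first by lia.
  by rewrite -natrM ler_nat; lia.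
rewrite ler_norml; move: h1 h2; rewrite -!(ler_nat R) !natrD; lra.
Qed.

(** * Integration by parts against the Freud weight *)

Section Weight.
Variables (R : realType) (m : nat) (t lambda : R).
Notation rho := (2 * lambda + 1).
Notation w := (freud_weight m t lambda).
Notation mu := (@lebesgue_measure R).

Definition exponent : {poly R} := t *: 'X^2 - 'X^(2 * m).

(** Writing |x| as a power of x^2 avoids the sign of x: away from 0 the weight is
    a composition of differentiable functions. *)
Lemma freud_weightE x :
  w x = (('X^2 : {poly R}).[x]) `^ (rho / 2) * expR exponent.[x].
Proof.
rewrite /freud_weight /exponent !hornerE; congr (_ * _).
rewrite -[in RHS](real_normK (num_real x)) -powR_mulrn // -powRrM.
by congr (_ `^ _); field.
Qed.

Lemma freud_weight_ge0 x : 0 <= w x.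
Proof. by rewrite mulr_ge0 ?powR_ge0 ?expR_ge0. Qed.

Lemma measurable_freud_weight : measurable_fun [set: R] w.
Proof.
rewrite (_ : w = (fun x => (('X^2 : {poly R}).[x]) `^ (rho / 2)) \*
   (fun x => expR exponent.[x])); last by apply/funext => x; rewrite freud_weightE.
apply: measurable_funM.
  have := measurableT_comp (measurable_powR (rho / 2)) (@measurable_poly R 'X^2 setT).
  exact.
by have := measurableT_comp (@measurable_expR R) (@measurable_poly R exponent setT).
Qed.

Lemma is_derive_freud_weight (x : R) : x != 0 ->
  is_derive x (1 : R) w ((rho / x + exponent^`().[x]) * w x).
Proof.
move=> x0.
have -> : w = ((fun y => y `^ (rho / 2)) \o horner ('X^2 : {poly R})) *
   (expR \o horner exponent) by apply/funext => y; rewrite freud_weightE.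
have x2 : 0 < ('X^2 : {poly R}).[x] by rewrite !hornerE exprn_even_gt0 ?x0.
have h1 := is_derive1_comp (is_derive1_powR (rho / 2) x2) (is_derive_poly 'X^2 x).
have h2 := is_derive1_comp (is_derive_expR exponent.[x]) (is_derive_poly exponent x).
apply: is_derive_eq (is_deriveM h1 h2) _.
change (('X^2).[x] `^ (rho / 2) * (expR exponent.[x] * exponent^`().[x])
  + expR exponent.[x] * (rho / 2 * ('X^2).[x] `^ (rho / 2 - 1) * ('X^2)^`().[x])
  = (rho / x + exponent^`().[x])
    * (('X^2).[x] `^ (rho / 2) * expR exponent.[x])).
have -> : ('X^2).[x] `^ (rho / 2) = ('X^2).[x] `^ (rho / 2 - 1) * x ^+ 2.
  rewrite -[in LHS](subrK 1 (rho / 2)) powRD; last by rewrite (gt_eqF x2) implybT.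
  by rewrite powRr1 ?ltW // hornerXn.
have -> : ('X^2)^`().[x] = 2 * x by rewrite derivXn !hornerE; ring.
move: (expR _) (_ `^ _) (_^`().[x]) => E a d; field.
by [].
Qed.

(** The factor X makes the product vanish at 0 even when rho < 0, as
    rho + 1 > 0. *)
Definition boundary (p : {poly R}) x := ('X * p).[x] * w x.

(** The polynomial q such that (x p w)' = q w, where
    w' = (rho / x + 2 t x - 2m x^(2m-1)) w. *)
Definition adjoint_derivative (p : {poly R}) : {poly R} :=
  ('X * p)^`() + rho *: p + (2 * t) *: ('X^2 * p) - m.*2%:R *: ('X^(m.*2) * p).

Lemma is_derive_boundary p (x : R) : (0 < m)%N -> x != 0 ->
  is_derive x (1 : R) (boundary p) ((adjoint_derivative p).[x] * w x).
Proof.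
move=> m0 x0.
have h := is_deriveM (is_derive_poly ('X * p) x) (is_derive_freud_weight x0).
apply: is_derive_eq h _.
change (('X * p).[x] * ((rho / x + exponent^`().[x]) * w x) + w x * (('X * p)^`()).[x]
  = (adjoint_derivative p).[x] * w x).
have -> : exponent^`().[x] = 2 * t * x - m.*2%:R * x ^+ (2 * m).-1.
  rewrite /exponent derivB derivZ !derivXn hornerD hornerN hornerZ !hornerMn.
  by rewrite !hornerXn expr1 -mul2n -[x *+ 2]mulr_natl -[(x ^+ _) *+ _]mulr_natl mulrCA mulrA.
have x2m : x ^+ m.*2 = x * x ^+ (2 * m).-1.
  by rewrite -exprS prednK ?muln_gt0 // mul2n.
rewrite /adjoint_derivative 2!hornerD hornerN hornerD !hornerZ.
rewrite ['X^2 * p]lock ['X^(m.*2) * p]lock hornerM -!lock !hornerM !hornerXn hornerX x2m.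
move: (w x) (_^`().[x]) (_ ^+ (2 * m).-1) => W D Y; field.
by [].
Qed.

Lemma boundary_FTC p a b : (0 < m)%N -> a < b -> 0 < a \/ b < 0 ->
  (\int[mu]_(x in `[a, b]) ((adjoint_derivative p).[x] * w x)%:E)%E
    = (boundary p b - boundary p a)%:E.
Proof.
move=> m0 ab sgn.
have nz x : x \in `[a, b] -> x != 0.
  rewrite in_itv /= => /andP[ax xb]; case: sgn => [a0|b0].
    by rewrite gt_eqF // (lt_le_trans a0).
  by rewrite lt_eqF // (le_lt_trans xb).
have dB x : x \in `[a, b] -> is_derive x (1 : R) (boundary p) ((adjoint_derivative p).[x] * w x).
  by move=> /nz; exact: is_derive_boundary.
have oc x : x \in `]a, b[ -> x \in `[a, b] by apply: subset_itv_oo_cc.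
rewrite (@continuous_FTC2 _ (fun x => (adjoint_derivative p).[x] * w x) (boundary p)) //.
- apply: derivable_within_continuous => x xab.
  have [d _] := is_deriveM (is_derive_poly (adjoint_derivative p) x)
     (is_derive_freud_weight (nz x xab)).
  exact: d.
- have cont x : x \in `[a, b] -> {for x, continuous (boundary p)}.
    by move=> /dB d; apply: differentiable_continuous; apply/derivable1_diffP.
  have aab : a \in `[a, b] by rewrite in_itv /= lexx ltW.
  have bab : b \in `[a, b] by rewrite in_itv /= lexx ltW.
  split.
  + by move=> x /oc /dB d; exact: ex_derive.
  + exact: cvg_at_right_filter (cont _ aab).
  + exact: cvg_at_left_filter (cont _ bab).
- by move=> x /oc /dB d; rewrite derive1E derive_val.
Qed.
End Weight.

Section Integrals.
Variable R : realType.
Notation mu := (@lebesgue_measure R).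

(** Dominated convergence by |g|; the point 0, where the sets may fail to
    converge, is negligible. *)
Lemma integral_exhaustion (g : R -> R) (A : nat -> set R) :
  mu.-integrable setT (EFin \o g) -> (forall n, measurable (A n)) ->
  (forall x, x != 0 -> \forall n \near \oo, A n x) ->
  (\int[mu]_(x in A n) (g x)%:E)%E @[n --> \oo] --> (\int[mu]_x (g x)%:E)%E.
Proof.
move=> ig mA cover.
have mg := measurable_int _ ig.
have [] // := @dominated_convergence _ _ _ mu setT measurableT
  (fun n => (EFin \o g) \_ (A n)) (EFin \o g) (abse \o (EFin \o g)).
- move=> n; apply: (iffLR (measurable_restrictT _ (mA n))).
  exact: (measurable_funS measurableT (@subsetT _ _) mg).
- exists [set 0]; split; [exact: measurable_set1 | exact: lebesgue_measure_set1 |].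
  move=> x /= h; apply: contrapT => x0; apply: h => _.
  apply: cvg_near_cst; have /cover : x != 0 by apply/eqP.
  by apply: filterS => n An; rewrite /patch mem_set.
- exact: integrable_abse.
- apply: aeW => x n _; rewrite /patch; case: ifP => _ //=.
  by rewrite ?normr0 ?lee_fin ?normr_ge0.
move=> _ _.
suff -> : (fun n => \int[mu]_(x in A n) (g x)%:E)%E =
          (fun n => \int[mu]_x ((EFin \o g) \_ (A n)) x)%E by [].
by apply/funext => n; rewrite integral_mkcond.
Qed.

(** Finiteness of the norms h_n makes each P_n^2 w integrable, |P_n| <= P_n^2 + 1
    then makes P_n w integrable, and the P_n span all polynomials. *)
Lemma integrable_poly (w : R -> R) (P : nat -> {poly R}) :
  measurable_fun setT w -> (forall x, 0 <= w x) -> P 0%N = 1 ->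
  monic_orthogonal w P ->
  forall p : {poly R}, mu.-integrable setT (EFin \o (fun x => p.[x] * w x)).
Proof.
move=> mw w0 P0 [Pm [h h0 hP]].
have mp (p : {poly R}) : measurable_fun setT (fun x => p.[x] * w x).
  by have := measurable_funM (@measurable_poly R p setT) mw.
have sq i : mu.-integrable setT (EFin \o (fun x => ((P i) ^+ 2).[x] * w x)).
  apply/integrableP; split; first by apply/measurable_EFinP; exact: mp.
  have := hP i i; rewrite eqxx => E.
  suff F : (fun x => `|((P i ^+ 2).[x] * w x)%:E|%E) = (fun x => ((P i).[x] * (P i).[x] * w x)%:E).
    by rewrite /= F E ltry.
  apply/funext => x; rewrite /= expr2 hornerM ger0_norm // mulr_ge0 //.
  by rewrite -expr2 sqr_ge0.
have iP i : mu.-integrable setT (EFin \o (fun x => (P i).[x] * w x)).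
  apply: (le_integrable measurableT _ _ (integrableD measurableT (sq i) (sq 0%N))).
    by apply/measurable_EFinP; exact: mp.
  move=> x _; rewrite /= ?EFinD lee_fin P0 expr1n hornerC -mulrDl normrM.
  rewrite [leRHS]normrM ler_wpM2r // hornerM [leRHS]ger0_norm.
    by move: ((P i).[x]) => u; have := sqr_ge0 (u - 1); have := sqr_ge0 (u + 1);
      rewrite !expr2; case: (ger0P u) => u0; lra.
  by rewrite addr_ge0 // -expr2 sqr_ge0.
have coefP n : (P n)`_n = 1.
  by have [/monicP + sz] := Pm n; rewrite lead_coefE sz.
suff H d (p : {poly R}) : (size p <= d)%N ->
    mu.-integrable setT (EFin \o (fun x => p.[x] * w x)) by move=> p; exact: H.
elim: d p => [|d IH] p sp.
  have -> : p = 0 by apply/eqP; rewrite -size_poly_eq0 -leqn0.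
  rewrite (_ : EFin \o _ = cst 0%E); first exact: integrable0.
  by apply/funext => x /=; rewrite horner0 mul0r.
pose q := p - p`_d *: P d.
have -> : EFin \o (fun x => p.[x] * w x) =
   ((fun x => (p`_d)%:E * ((P d).[x] * w x)%:E) \+ (fun x => (q.[x] * w x)%:E))%E.
  apply/funext => x /=; rewrite -EFinM -EFinD /q hornerD hornerN hornerZ.
  by congr (_%:E); ring.
apply: integrableD => //; first by apply: integrableZl => //; exact: iP.
apply: IH; apply/leq_sizeP => j; rewrite leq_eqVlt => /orP[/eqP <-|dj].
  by rewrite coefB coefZ coefP mulr1 subrr.
rewrite coefB coefZ [p`_j]nth_default ?(leq_trans sp) //.
by rewrite [(P d)`_j]nth_default ?mulr0 ?subr0 //; have [_ ->] := Pm d.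
Qed.
End Integrals.

Section BoundaryTerms.
Variables (R : realType) (m : nat) (t lambda : R).
Hypotheses (m2 : (2 <= m)%N) (hlambda : -1 < lambda).
Notation rho := (2 * lambda + 1).
Notation w := (freud_weight m t lambda).
Notation mu := (@lebesgue_measure R).

Lemma expR_ge_pow (y : R) k : 0 <= y -> (0 < k)%N -> (y / k%:R) ^+ k <= expR y.
Proof.
move=> y0 k0.
have -> : expR y = expR (y / k%:R) ^+ k.
  by rewrite -expRM_natl mulrCA divff ?mulr1 // pnatr_eq0 -lt0n.
rewrite lerXn2r ?nnegrE ?expR_ge0 ?divr_ge0 //.
by apply: le_trans (expR_ge1Dx _); rewrite lerDr.
Qed.

(** For |x| >= 1 + |t| the exponent t x^2 - x^(2m) is at most -|x|, and
    exp(-|x|) |x|^K <= K^K. *)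
Lemma monomial_decay k : exists C : R, forall x : R,
  1 + `|t| <= `|x| -> `|x| ^+ k.+1 * w x <= C.
Proof.
pose K := (k.+1 + Num.bound `|rho|)%N.
exists (K%:R ^+ K) => x tx.
have x1 : 1 <= `|x| by apply: le_trans tx; rewrite lerDl.
have x0 : 0 < `|x| by exact: lt_le_trans x1.
rewrite /freud_weight mulrA.
apply: (@le_trans _ _ (`|x| ^+ K * expR (- `|x|))).
  apply: ler_pM => //; rewrite ?mulr_ge0 ?exprn_ge0 ?powR_ge0 ?expR_ge0 //.
    rewrite exprD ler_wpM2l ?exprn_ge0 // -powR_mulrn //.
    apply: ler_powR => //; apply: le_trans (ler_norm _) _.
    exact/ltW/archi_boundP.
  rewrite ler_expR -[x ^+ 2]real_normK ?num_real //.
  rewrite exprM -[x ^+ 2]real_normK ?num_real //.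
  set y := `|x| in tx x1 x0 *.
  have y2 : 1 <= y ^+ 2 by rewrite exprn_ege1.
  have : (y ^+ 2) ^+ 2 <= (y ^+ 2) ^+ m by rewrite ler_weXn2l.
  have : y <= y ^+ 2 by rewrite ler_eXnr.
  have : t * y ^+ 2 <= (y - 1) * y ^+ 2.
    rewrite ler_wpM2r ?sqr_ge0 //; have := ler_norm t; lra.
  have : 0 <= (y ^+ 2 - y) * y ^+ 2.
    by rewrite mulr_ge0 ?sqr_ge0 // subr_ge0 ler_eXnr.
  rewrite [(y ^+ 2) ^+ 2]expr2; nra.
have K0 : (0 < K)%N by [].
have := expR_ge_pow (ltW x0) K0; rewrite expr_div_n ler_pdivrMr ?exprn_gt0 ?ltr0n //.
by rewrite expRN ler_pdivrMr ?expR_gt0 // mulrC.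
Qed.

Lemma polynomial_decay (q : {poly R}) : exists C : R, forall x : R,
  1 + `|t| <= `|x| -> `|q.[x] * w x| <= C / `|x|.
Proof.
have [C hC] := choice monomial_decay.
exists (\sum_(i < size q) `|q`_i| * `|C i|) => x tx.
have x0 : 0 < `|x| by apply: lt_le_trans tx; rewrite ltr_pwDl.
rewrite ler_pdivlMr // horner_coef mulr_suml.
apply: le_trans (_ : (\sum_(i < size q) `|q`_i * x ^+ i * w x|) * `|x| <= _).
  by rewrite ler_pM2r // ler_norm_sum.
rewrite mulr_suml; apply: ler_sum => i _.
have -> : `|q`_i * x ^+ i * w x| * `|x| = `|q`_i| * (`|x| ^+ i.+1 * w x).
  rewrite (normrM _ (w x)) normrM normrX (ger0_norm (freud_weight_ge0 _ _ _ _)) exprS.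
  ring.
rewrite ler_wpM2l //; apply: le_trans (ler_norm _); exact: hC.
Qed.

Lemma cvg_boundary_infty (p : {poly R}) (s : R) : `|s| = 1 ->
  boundary m t lambda p (s * n.+1%:R) @[n --> \oo] --> 0.
Proof.
move=> s1; have [C hC] := polynomial_decay ('X * p).
apply: norm_cvg0.
apply: (@squeeze_cvgr _ _ _ _ (fun=> 0) (fun n => C * harmonic n)); last 2 first.
- exact: cvg_cst.
- by rewrite -[X in _ --> X](mulr0 C); apply: cvgMr; exact: cvg_harmonic.
near=> n; rewrite normr_ge0 /= /boundary.
apply: le_trans (hC _ _) _; rewrite normrM s1 mul1r ger0_norm //.
near: n; exists (Num.bound (1 + `|t|)) => // n /= hn.
apply: le_trans (ltW (archi_boundP _)) _; first by rewrite addr_ge0.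
by rewrite ler_nat; apply: leq_trans hn _.
Unshelve. all: by end_near.
Qed.

Lemma cvg_boundary_0 (p : {poly R}) (s : R) : `|s| = 1 ->
  boundary m t lambda p (s * n.+1%:R^-1) @[n --> \oo] --> 0.
Proof.
move=> s1.
have E n : boundary m t lambda p (s * n.+1%:R^-1) =
   s * (n.+1%:R^-1 `^ (rho + 1)) *
   (p.[s * n.+1%:R^-1] * expR (exponent m t).[s * n.+1%:R^-1]).
  rewrite /boundary /freud_weight hornerM hornerX.
  set e : R := n.+1%:R^-1; have e0 : 0 < e by rewrite invr_gt0.
  rewrite normrM s1 mul1r (gtr0_norm e0).
  have -> : e `^ (rho + 1) = e `^ rho * e.
    by rewrite powRD ?(gt_eqF e0) ?implybT // powRr1 // ltW.
  have -> : t * (s * e) ^+ 2 - (s * e) ^+ (2 * m) = (exponent m t).[s * e].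
    by rewrite hornerD hornerN hornerZ !hornerXn.
  by move: (expR _) => E; ring.
have -> : (fun n => boundary m t lambda p (s * n.+1%:R^-1)) =
   (fun n => s * (n.+1%:R^-1 `^ (rho + 1))) \*
   (fun n => p.[s * n.+1%:R^-1] * expR (exponent m t).[s * n.+1%:R^-1]).
  by apply/funext => n; exact: E.
have h0 : harmonic n @[n --> \oo] --> (0 : R) := cvg_harmonic.
have u0 : s * harmonic n @[n --> \oo] --> (0 : R).
  by rewrite -[X in _ --> X](mulr0 s); apply: cvgMr.
have k1 : (n.+1%:R^-1 : R) `^ (rho + 1) @[n --> \oo] --> (0 : R).
  have rho1 : 0 < rho + 1 by have := hlambda; lra.
  have /cvg_at_rightP /(_ harmonic) := powR_cvg0 rho1; apply; split => // n /=.
  by rewrite invr_gt0.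
have -> : 0 = s * 0 * (p.[0] * expR (exponent m t).[0]) :> R by rewrite mulr0 mul0r.
apply: cvgM; first exact: cvgMr.
apply: cvgM.
  exact: (cvg_comp _ _ u0 (@continuous_horner _ p 0)).
have e0 := cvg_comp _ _ u0 (@continuous_horner _ (exponent m t) 0).
exact: (cvg_comp _ _ e0 (@continuous_expR _ (exponent m t).[0])).
Qed.

Hypothesis integrable_w : forall p : {poly R},
  mu.-integrable setT (EFin \o (fun x => p.[x] * w x)).

(** The fundamental theorem of calculus on [1/n, n] and [-n, -1/n], which avoid
    the possible singularity at 0; the four boundary terms tend to 0. *)
Lemma integral_adjoint_derivative (p : {poly R}) :
  (\int[mu]_x ((adjoint_derivative m t lambda p).[x] * w x)%:E)%E = 0%E.
Proof.
have m0 : (0 < m)%N by exact: leq_trans m2.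
pose A n := `[n.+2%:R^-1, n.+2%:R]%classic `|` `[- n.+2%:R, - n.+2%:R^-1]%classic : set R.
pose g x := (adjoint_derivative m t lambda p).[x] * w x.
have e0 n : 0 < n.+2%:R^-1 :> R by rewrite invr_gt0.
have le1 n : n.+2%:R^-1 < n.+2%:R :> R.
  by apply: (@lt_trans _ _ 1); rewrite ?invf_lt1 ?ltr1n.
have mA n : measurable (A n) by apply: measurableU; exact: measurable_itv.
have lim1 := @integral_exhaustion R g A (integrable_w _) mA _.
have {}lim1 : (\int[mu]_(x in A n) (g x)%:E)%E @[n --> \oo] --> (\int[mu]_x (g x)%:E)%E.
  apply: lim1 => x x0.
  have x0' : 0 < `|x| by rewrite normr_gt0.
  exists (maxn (Num.bound `|x|) (Num.bound `|x|^-1)) => // n /= hn.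
  have h1 : `|x| <= n.+2%:R.
    apply: le_trans (ltW (archi_boundP _)) _ => //; rewrite ler_nat; lia.
  have h2 : n.+2%:R^-1 <= `|x|.
    rewrite -[leRHS]invrK lef_pV2 ?posrE ?invr_gt0 //.
    apply: le_trans (ltW (archi_boundP _)) _; rewrite ?invr_ge0 // ler_nat; lia.
  rewrite /A /= !in_itv /=; have [xp|xn] := leP 0 x.
    by left; rewrite ger0_norm // in h1 h2; apply/andP.
  by right; rewrite ltr0_norm // in h1 h2; rewrite lerNl h1 lerNr h2.
pose b n := (boundary m t lambda p (1 * n.+1%:R) - boundary m t lambda p (1 * n.+1%:R^-1))
  + (boundary m t lambda p (-1 * n.+1%:R^-1) - boundary m t lambda p (-1 * n.+1%:R)).
have b0 : b n @[n --> \oo] --> (0 : R).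
  have -> : 0 = (0 - 0) + (0 - 0) :> R by ring.
  apply: cvgD; apply: cvgB; solve [apply: cvg_boundary_infty; rewrite ?normrN normr1 //
    | apply: cvg_boundary_0; rewrite ?normrN normr1 //].
have Ab n : (\int[mu]_(x in A n) (g x)%:E)%E = (b n.+1)%:E.
  rewrite integral_setU //=; last 2 first.
  - by apply: (measurable_funS measurableT) => //; exact: measurable_int (integrable_w _).
  - apply/disj_setPS => x []; rewrite /= !in_itv /= => /andP[h1 _] /andP[_ h2].
    by have := lt_le_trans (e0 n) (le_trans h1 h2); rewrite oppr_gt0 ltNge ltW.
  rewrite !boundary_FTC //; [|by rewrite ltrN2|by right; rewrite oppr_lt0|by left].
  by rewrite /b !mul1r !mulN1r.
have lim2 : (\int[mu]_(x in A n) (g x)%:E)%E @[n --> \oo] --> 0%E.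
  under eq_cvg do rewrite Ab.
  apply: cvg_EFin; first by near=> n.
  by have := b0; rewrite -(cvg_shiftS).
exact: (cvg_unique _ lim1 lim2).
Unshelve. all: by end_near.
Qed.
End BoundaryTerms.

(** * The string equation *)

Section StringEquation.
Variables (R : realType) (m : nat) (t rho : R).
Variables (P : nat -> {poly R}) (beta h : nat -> R) (I : {poly R} -> R).
Hypothesis I_linear : forall a p q, I (a *: p + q) = a * I p + I q.
Hypothesis P_monic : forall n, P n \is monic /\ size (P n) = n.+1.
Hypothesis h_gt0 : forall n, 0 < h n.
Hypothesis P_orth : forall i j, I (P i * P j) = if i == j then h i else 0.
Hypothesis P_rec : forall n, P n.+1 = 'X * P n - beta n *: prev_poly P n.

Let I0 : I 0 = 0.
Proof. by have := I_linear (-1) 0 0; rewrite scaler0 addr0 mulN1r addNr. Qed.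

Let IZ a p : I (a *: p) = a * I p.
Proof. by rewrite -[a *: p]addr0 I_linear I0 addr0. Qed.

Let ID p q : I (p + q) = I p + I q.
Proof. by rewrite -[p in LHS]scale1r I_linear mul1r. Qed.

Let X_mul_P n : 'X * P n = P n.+1 + beta n *: prev_poly P n.
Proof. by rewrite P_rec subrK. Qed.

(** Multiplication by X acts on the P_i by the Jacobi matrix of beta. *)
Lemma moment_walk k i j : I ('X^k * P i * P j) = walk beta k i j * h j.
Proof.
elim: k i => [|k IH] i /=.
  by rewrite expr0 mul1r P_orth; case: eqP => [->|_]; rewrite ?mul1r ?mul0r.
rewrite exprSr -[_ * 'X * _]mulrA X_mul_P mulrDr mulrDl ID IH mulrDl.
congr (_ + _); case: i => [|i] /=.
  by rewrite scaler0 mulr0 mul0r I0 mul0r.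
by rewrite -scalerAr -scalerAl IZ IH mulrA.
Qed.

(** Compute the integral of X P_(n+1) P_n from either factor. *)
Lemma norm_rec n : h n.+1 = beta n.+1 * h n.
Proof.
have up : walk beta 1 n n.+1 = 1.
  by case: n => [|n] /=; rewrite ?eqxx ?ltn_eqF ?mulr0 ?addr0 //; lia.
have down : walk beta 1 n.+1 n = beta n.+1.
  by rewrite /= eqxx mulr1 gtn_eqF ?add0r //; lia.
by rewrite -[LHS]mul1r -up -down -!moment_walk mulrAC.
Qed.

Lemma beta_gt0 n : 0 < beta n.+1.
Proof. by have := h_gt0 n.+1; rewrite norm_rec pmulr_lgt0. Qed.

Let size_P n : size (P n) = n.+1. Proof. by have [] := P_monic n. Qed.

Let coef_P n : (P n)`_n = 1.
Proof. by have [/monicP + sz] := P_monic n; rewrite lead_coefE sz. Qed.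

Lemma orth_low (q : {poly R}) n : (size q <= n)%N -> I (q * P n) = 0.
Proof.
suff H d : (d <= n)%N -> (size q <= d)%N -> I (q * P n) = 0 by exact: (H n).
elim: d q => [|d IH] q dn sq.
  by move: sq; rewrite leqn0 size_poly_eq0 => /eqP ->; rewrite mul0r I0.
have -> : q = q`_d *: P d + (q - q`_d *: P d) by rewrite addrC subrK.
rewrite mulrDl ID -scalerAl IZ P_orth ltn_eqF // mulr0 add0r IH //; first exact: ltnW.
apply/leq_sizeP => j; rewrite leq_eqVlt => /orP[/eqP <-|dj].
  by rewrite coefB coefZ coef_P mulr1 subrr.
by rewrite coefB coefZ [q`_j]nth_default ?(leq_trans sq) // [(P d)`_j]nth_default ?size_P // mulr0 subr0.
Qed.

Lemma orth_lead (q : {poly R}) n : (size q <= n.+1)%N -> I (q * P n) = q`_n * h n.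
Proof.
move=> sq; have -> : q = q`_n *: P n + (q - q`_n *: P n) by rewrite addrC subrK.
rewrite mulrDl ID -scalerAl IZ P_orth eqxx orth_low ?addr0.
  by rewrite coefD coefB !coefZ coef_P mulr1 subrr addr0.
apply/leq_sizeP => j; rewrite leq_eqVlt => /orP[/eqP <-|dj].
  by rewrite coefB coefZ coef_P mulr1 subrr.
by rewrite coefB coefZ [q`_j]nth_default ?(leq_trans sq) // [(P n)`_j]nth_default ?size_P // mulr0 subr0.
Qed.

Lemma odd_P_root n : odd n -> (P n).[0] = 0.
Proof.
suff H k : (P k.*2.+1).[0] = 0.
  by move=> on; rewrite -(odd_double_half n) on H.
elim: k => [|k IH]; first by rewrite P_rec /= scaler0 subr0 !hornerE ?mul0r.
by rewrite doubleS P_rec /= hornerD hornerN hornerZ IH mulr0 subr0 hornerM hornerX mul0r.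
Qed.

Lemma odd_P_factor n : odd n ->
  exists q : {poly R}, [/\ P n = 'X * q, size q = n & q`_n.-1 = 1].
Proof.
move=> on; have /factor_theorem [q Pq] : root (P n) 0 by rewrite rootE odd_P_root.
rewrite subr0 in Pq; exists q.
have q0 : q != 0.
  by apply/eqP => q0; have := size_P n; rewrite Pq q0 mul0r size_poly0.
have sq : size q = n by apply: succn_inj; rewrite -[RHS]size_P Pq size_mulX.
split => //; first by rewrite Pq mulrC.
by have := coef_P n; rewrite Pq coefMX; case: (n) on.
Qed.

Hypothesis m_gt0 : (0 < m)%N.
Hypothesis moment_identity : forall q : {poly R},
  I (('X * q)^`()) + rho * I q + 2 * t * I ('X^2 * q)
    - m.*2%:R * I ('X^(m.*2) * q) = 0.

(** Take q = P_(n+1) P_n / X in the moment identity; the product is divisible by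
    X because one of the two polynomials is odd.  In (X q)' = P_(n+1)' P_n +
    P_(n+1) P_n' only the first term survives, with integral (n+1) h_n. *)
Lemma string_equation n :
  n.+1%:R + rho * (odd n.+1)%:R + 2 * t * beta n.+1
    = m.*2%:R * freud_sum beta m n.+1.
Proof.
have [q [Pq Iq]] : exists q, P n.+1 * P n = 'X * q /\ I q = (odd n.+1)%:R * h n.
  have [on|en] := boolP (odd n.+1).
    have [q [Pq sq cq]] := odd_P_factor on.
    exists (q * P n); split; first by rewrite Pq mulrA.
    by rewrite orth_lead ?sq //; rewrite cq.
  have on : odd n by move: en; rewrite /= negbK.
  have [q [Pq sq cq]] := odd_P_factor on.
  exists (q * P n.+1); split; first by rewrite Pq mulrC mulrA.
  by rewrite orth_low ?sq // mul0r.
have dI : I (('X * q)^`()) = n.+1%:R * h n.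
  rewrite -Pq derivM ID [P n.+1 * _]mulrC orth_lead; last first.
    by apply: leq_trans (size_poly _ _) _; rewrite size_P.
  rewrite coef_deriv coef_P orth_low ?addr0 //.
  by apply: leq_trans (leq_trans (size_poly _ _) _) (leqnSn _); rewrite size_P.
have I2 : I ('X^2 * q) = h n.+1.
  rewrite exprSr -mulrA -Pq [P n.+1 * _]mulrC mulrA moment_walk /= eqxx.
  case: (n) => [|k]; first by rewrite addr0 mul1r.
  by rewrite ltn_eqF ?mulr0 ?addr0 ?mul1r //; lia.
have I2m : I ('X^(m.*2) * q) = walk beta m.*2.-1 n n.+1 * h n.+1.
  rewrite -moment_walk -[in LHS](prednK (_ : (0 < m.*2)%N)) ?double_gt0 //.
  by rewrite exprSr -mulrA -Pq [P n.+1 * _]mulrC mulrA.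
have := moment_identity q; rewrite dI Iq I2 I2m norm_rec /freud_sum /= => E.
apply: (mulIf (lt0r_neq0 (h_gt0 n))); apply/eqP; rewrite -subr_eq0; apply/eqP.
rewrite -[RHS]E; ring.
Qed.

End StringEquation.

Section FreudRecurrence.
Variable R : realType.
Notation mu := (@lebesgue_measure R).

Lemma freud_string_equation (m : nat) (t lambda : R) (beta : nat -> R) :
  (2 <= m)%N -> -1 < lambda ->
  recurrence_coefficients (freud_weight m t lambda) beta ->
  forall n, 0 < beta n.+1 /\
    n.+1%:R + (2 * lambda + 1) * (odd n.+1)%:R + 2 * t * beta n.+1
      = m.*2%:R * freud_sum beta m n.+1.
Proof.
move=> m2 hlambda [P [orthP P0 Prec]] n.
set w := freud_weight m t lambda in orthP.
have iw := integrable_poly (measurable_freud_weight m t lambda)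
  (freud_weight_ge0 m t lambda) P0 orthP.
case: orthP => Pm [h h0 hP].
pose I (p : {poly R}) := \int[mu]_x (p.[x] * w x).
have I_linear a p q : I (a *: p + q) = a * I p + I q.
  have iZ : mu.-integrable setT (EFin \o (fun x => a * (p.[x] * w x))).
    by have := integrableZl measurableT a (iw p); under eq_fun do rewrite /= -EFinM.
  rewrite /I -RintegralZl // -RintegralD //.
  by apply: eq_Rintegral => x _; rewrite hornerD hornerZ mulrDl -mulrA.
have I_orth i j : I (P i * P j) = if i == j then h i else 0.
  rewrite /I /Rintegral; have /= -> : (\int[mu]_x ((P i * P j).[x] * w x)%:E)%E =
    (if i == j then h i else 0)%:E by rewrite -hP; apply: eq_integral => x _; rewrite hornerM.
  by [].
have I_moment q : I (('X * q)^`()) + (2 * lambda + 1) * I q + 2 * t * I ('X^2 * q)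
    - m.*2%:R * I ('X^(m.*2) * q) = 0.
  have <- : I (adjoint_derivative m t lambda q) = 0.
    by rewrite /I /Rintegral (integral_adjoint_derivative m2 hlambda iw).
  rewrite /adjoint_derivative.
  have -> : ('X * q)^`() + (2 * lambda + 1) *: q + (2 * t) *: ('X^2 * q)
      - m.*2%:R *: ('X^(m.*2) * q) = (- m.*2%:R) *: ('X^(m.*2) * q)
      + ((2 * t) *: ('X^2 * q) + ((2 * lambda + 1) *: q + ('X * q)^`())).
    by rewrite scaleNr [RHS]addrC; congr (_ + _); rewrite addrC; congr (_ + _); rewrite addrC.
  rewrite !I_linear; ring.
split; first exact: (beta_gt0 I_linear h0 I_orth Prec).
exact: (string_equation I_linear Pm h0 I_orth Prec (ltnW m2) I_moment).
Qed.

End FreudRecurrence.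

(** * Growth of the recurrence coefficients and the limit *)

Section Asymptotics.
Variables (R : realType) (m : nat) (a D c : R) (b : nat -> R).
Hypotheses (m2 : (2 <= m)%N) (a_ge0 : 0 <= a) (D_ge0 : 0 <= D).
Hypothesis b_gt0 : forall n, 0 < b n.
Hypothesis string : forall n, (0 < n)%N ->
  `|m.*2%:R * freud_sum b m n - n%:R| <= D + a * b n.
Hypotheses (c_gt0 : 0 < c)
  (c_fixed : m.*2%:R * (c ^+ m * 'C(m.*2.-1, m.-1)%:R) = 1).

Let m0 : (0 < m)%N. Proof. exact: leq_trans m2. Qed.
Let E : R := D + a * (a + 1).

Let E_ge0 : 0 <= E.
Proof. by rewrite addr_ge0 // mulr_ge0 // addr_ge0. Qed.

(** The string equation gives 2 b_n^m <= n + D + a b_n; the last term is absorbed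
    by b_n^m as soon as b_n exceeds a + 1, since m >= 2. *)
Lemma exp_growth n : (0 < n)%N -> b n ^+ m <= n%:R + E.
Proof.
move=> n0; have b0 := ltW (b_gt0 n).
have h1 := exp_le_freud_sum (fun i => ltW (b_gt0 i)) n0 m0.
have := string n0; rewrite ler_norml => /andP[_ h2].
have h3 : 2 * freud_sum b m n <= m.*2%:R * freud_sum b m n.
  rewrite ler_wpM2r //; first by apply: freud_sum_ge0 => i; exact: ltW.
  by rewrite ler_nat; lia.
have h4 : a * b n <= b n ^+ m + a * (a + 1).
  have [ba|ba] := leP (b n) (a + 1).
    by rewrite -[leLHS]add0r lerD ?exprn_ge0 // ler_wpM2l.
  rewrite -[leLHS]addr0 lerD //; last by rewrite mulr_ge0 // addr_ge0.
  apply: (@le_trans _ _ (b n ^+ 2)); first by rewrite expr2 ler_wpM2r //; lra.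
  by rewrite ler_weXn2l //; have := a_ge0; lra.
rewrite /E; lra.
Qed.

(** This gives b_n = o(n), so that the linear term of the string equation is
    negligible. *)
Lemma sqr_growth n : (0 < n)%N -> b n ^+ 2 <= n%:R + E + 1.
Proof.
move=> n0; have h := exp_growth n0; have b0 := ltW (b_gt0 n).
have [b1|b1] := leP (b n) 1.
  apply: (@le_trans _ _ 1); first by rewrite exprn_ile1.
  by rewrite lerDr addr_ge0.
by apply: le_trans (_ : b n ^+ m <= _); [rewrite ler_weXn2l // ltW | lra].
Qed.

(** Rescale by s = N^(1/m).  On a window of fixed radius around N, n / N tends to
    1, so the scaled coefficients x solve the string equation up to e1 (half of
    which pays for n - N and D, half for a b_n).  The upper bound B comes from
    [exp_growth]; the lower bound L from the equation itself, since F_n(x) is at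
    most x_n (1 + B)^(2m-1). *)
Lemma recurrence_asymptotics (tau : R) : 0 < tau -> exists N0, forall N s,
  (N0 <= N)%N -> 0 < s -> s ^+ m = N%:R -> `|b N / s - c| < tau.
Proof.
move=> tau0.
pose B := 3 + c; have B0 : 0 < B by rewrite addr_gt0.
have m20 : 0 < m.*2%:R :> R by rewrite ltr0n double_gt0.
pose Q : R := (1 + B) ^+ m.*2.-1.
have Q0 : 0 < Q by rewrite exprn_gt0 // addr_gt0.
pose L := Num.min c (2 * m.*2%:R * Q)^-1.
have L0 : 0 < L by rewrite lt_min c_gt0 invr_gt0 !mulr_gt0.
have Lc : L <= c by rewrite ge_min lexx.
have cB : c <= B by rewrite lerDr.
have [r [e [e0 rig]]] := rigidity m0 L0 Lc cB tau0.
pose r2 := (r + m.*2)%N.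
pose e1 := Num.min (m.*2%:R * e) 2^-1.
have e10 : 0 < e1 by rewrite lt_min mulr_gt0 //= invr_gt0.
pose e2 := e1 / (2 * (a + 1)).
have a1 : 0 < a + 1 by rewrite ltr_wpDl.
have e20 : 0 < e2 by rewrite divr_gt0 // mulr_gt0.
pose N0 := (r2 + m.*2 + (Num.bound (E + 1) + Num.bound (2 * (r2%:R + D) / e1)
   + Num.bound (4 / e2 ^+ 2))).+1%N.
exists N0 => N s hN s0 sm.
have [Nr N3 N4 N5] : [/\ (r2 + m.*2 < N)%N, (Num.bound (E + 1) <= N)%N,
    (Num.bound (2 * (r2%:R + D) / e1) <= N)%N & (Num.bound (4 / e2 ^+ 2) <= N)%N].
  move: hN; rewrite /N0; move: (Num.bound (E + 1)) (Num.bound (2 * (r2%:R + D) / e1)).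
  by move: (Num.bound (4 / e2 ^+ 2)) (r2); clear; move=> *; split; lia.
have nbound (u : R) : 0 <= u -> (Num.bound u <= N)%N -> u <= N%:R.
  move=> u0 uN; apply: le_trans (ltW (archi_boundP u0)) _.
  by rewrite ler_nat.
have NE : E + 1 <= N%:R by apply: nbound => //; rewrite addr_ge0.
have N1 : 2 * (r2%:R + D) <= e1 * N%:R.
  rewrite [leRHS]mulrC -ler_pdivrMr //; apply: nbound => //.
  by rewrite divr_ge0 ?(ltW e10) // mulr_ge0 // addr_ge0.
have N2 : 4 <= e2 ^+ 2 * N%:R.
  rewrite [leRHS]mulrC -ler_pdivrMr ?exprn_gt0 //; apply: nbound => //.
  by rewrite divr_ge0 // sqr_ge0.
have Npos : 0 < N%:R :> R by rewrite ltr0n; exact: leq_ltn_trans Nr.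
pose x n := s^-1 * b n.
have x0 n : 0 < x n by rewrite mulr_gt0 ?invr_gt0.
have in2 n : window N r2 n -> [/\ (0 < n)%N, n%:R <= 2 * N%:R :> R,
    `|n%:R - N%:R| <= r2%:R :> R & (m.*2 <= n)%N].
  move=> wn; have [mn n2 nN] := window_bounds R Nr wn; split => //.
    exact: leq_ltn_trans mn.
  exact: ltnW.
have xB n : window N r2 n -> x n <= B.
  move=> /in2[n0 n2 _ _].
  have : x n ^+ m <= 3.
    rewrite exprMn exprVn sm mulrC ler_pdivrMr //.
    apply: le_trans (exp_growth n0) _; lra.
  have [x3|x3] := leP (x n) 3 => h; first by rewrite /B; have := c_gt0; lra.
  have : x n <= x n ^+ m by rewrite ler_eXnr //; lra.
  lra.
have bN n : window N r2 n -> b n <= e2 * N%:R.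
  move=> /in2[n0 n2 _ _].
  have h : b n ^+ 2 <= (e2 * N%:R) ^+ 2.
    apply: le_trans (sqr_growth n0) _.
    apply: (@le_trans _ _ (4 * N%:R)); first by lra.
    by rewrite exprMn [N%:R ^+ 2]expr2 mulrA ler_wpM2r // ltW.
  by rewrite -ler_sqr ?nnegrE // ltW // mulr_gt0.
have xfreud n : window N r2 n ->
    `|m.*2%:R * (freud_sum x m n - freud_sum (fun=> c) m n)| <= e1.
  move=> wn; have [n0 n2 nN mn] := in2 n wn.
  rewrite mulrBr freud_sum_const // c_fixed /x freud_sum_scale // exprVn sm.
  have -> : m.*2%:R * (N%:R^-1 * freud_sum b m n) - 1 =
     ((m.*2%:R * freud_sum b m n - n%:R) + (n%:R - N%:R)) / N%:R.
    by field; rewrite gt_eqF.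
  rewrite normrM normfV [`|N%:R|]ger0_norm // ler_pdivrMr //.
  apply: le_trans (ler_normD _ _) _.
  have h1 := string n0.
  have h2 : a * b n <= e1 * N%:R / 2.
    apply: (@le_trans _ _ ((a + 1) * (e2 * N%:R))).
      by apply: ler_pM => //; [exact: ltW | rewrite lerDl | exact: bN].
    rewrite le_eqVlt; apply/orP; left; apply/eqP; rewrite /e2; field.
    by rewrite gt_eqF.
  lra.
have sub n : window N r n -> window N r2 n by apply: window_sub; exact: leq_addr.
rewrite -[b N / s]mulrC -/(x N).
apply: (rig N x); first by apply: leq_ltn_trans Nr; rewrite /r2 -addnA leq_addr.
- move=> n wn; apply/andP; split; last by apply/xB/sub.
  have [n0 _ _ mn] := in2 n (sub n wn).
  (* Truncate at B to get a global bound; nothing changes near n. *)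
  pose y i := Num.min (x i) B.
  have yx : freud_sum x m n = freud_sum y m n.
    apply: eq_freud_sum => // i i1 i2; rewrite /y min_l //; apply: xB.
    exact: window_near wn i1 i2.
  have yB i : 0 <= y i <= B by rewrite /y le_min (ltW (x0 i)) (ltW B0) /= ge_min lexx orbT.
  have yn : y n = x n by rewrite /y min_l //; apply/xB/sub.
  have := xfreud n (sub n wn).
  rewrite mulrBr freud_sum_const // c_fixed ler_norml => /andP[h _].
  have h2 : e1 <= 2^-1 by rewrite ge_min lexx orbT.
  have := freud_sum_bound m n yB; rewrite -yx yn -/Q => h3.
  apply: (@le_trans _ _ (2 * m.*2%:R * Q)^-1); first by rewrite ge_min lexx orbT.
  rewrite -[leLHS]mul1r ler_pdivrMr ?mulr_gt0 //.
  have := ler_wpM2l (ltW m20) h3; lra.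
- move=> n wn; have := xfreud n (sub n wn).
  rewrite normrM [`|_%:R|]ger0_norm // => h.
  rewrite -(ler_pM2l m20); apply: le_trans h _.
  by rewrite ge_min lexx.
Qed.
End Asymptotics.

Section Constant.
Variable R : realType.

Lemma pochhammer_half m : pochhammer (2^-1 : R) m * 4 ^+ m * m`!%:R = (m.*2)`!%:R.
Proof.
elim: m => [|m IH]; first by rewrite /pochhammer big_ord0 !fact0 expr0 !mulr1.
rewrite /pochhammer big_ord_recr /= -/(pochhammer 2^-1 m) exprS doubleS !factS !natrM -IH.
rewrite -!natr1 -mul2n natrM; by field.
Qed.

Lemma pochhammer_half_gt0 m : 0 < pochhammer (2^-1 : R) m.
Proof. by apply: prodr_gt0 => i _; rewrite ltr_wpDr // invr_gt0. Qed.

(** After clearing denominators this is (1/2)_m 4^m m! = (2m)!. *)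
Lemma limit_fixed m (c := 4^-1 * ((m.-1)`!%:R / pochhammer (2^-1 : R) m) `^ m%:R^-1) :
  (0 < m)%N -> m.*2%:R * (c ^+ m * 'C(m.*2.-1, m.-1)%:R) = 1.
Proof.
move=> m0; have p0 := pochhammer_half_gt0 m.
rewrite /c exprMn -[(_ `^ _) ^+ m]powR_mulrn ?powR_ge0 // -powRrM mulVf ?pnatr_eq0 -?lt0n //.
rewrite powRr1 ?divr_ge0 ?(ltW p0) // exprVn.
have := pochhammer_half m; set p := pochhammer _ _ in p0 *.
have -> : (m.*2)`! = (m.*2 * ('C(m.*2.-1, m.-1) * (m.-1`! * m`!)))%N.
  rewrite -[in LHS](prednK (_ : 0 < m.*2)%N) ?double_gt0 // factS prednK ?double_gt0 //.
  rewrite -(@bin_fact m.*2.-1 m.-1); last by lia.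
  by rewrite (_ : m.*2.-1 - m.-1 = m)%N //; lia.
rewrite !natrM => h.
have f0 : m`!%:R != 0 :> R by rewrite pnatr_eq0 -lt0n fact_gt0.
have q0 : 4 ^+ m != 0 :> R by rewrite expf_neq0.
have h' : p * 4 ^+ m = m.*2%:R * ('C(m.*2.-1, m.-1)%:R * (m.-1)`!%:R).
  by apply: (mulIf f0); rewrite h !mulrA.
transitivity (m.*2%:R * ('C(m.*2.-1, m.-1)%:R * (m.-1)`!%:R) / (p * 4 ^+ m)).
  move: q0 (lt0r_neq0 p0); move: (4 ^+ m) ('C(_, _)%:R) ((m.-1)`!%:R) (m.*2%:R) => F u v x F0 pn0.
  by field; rewrite F0 pn0.
by rewrite -h' divff // mulf_neq0 // lt0r_neq0.
Qed.
End Constant.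

Theorem theorem4p6 (R : realType) (m : nat) (t lambda : R) (beta : nat -> R)
    (hm : (2 <= m)%N) (hlambda : -1 < lambda)
    (hbeta : recurrence_coefficients (freud_weight m t lambda) beta) :
  (fun n : nat => beta n / n%:R `^ m%:R^-1) @ \oo -->
    4^-1 * ((m.-1)`!%:R / pochhammer (2^-1 : R) m) `^ m%:R^-1.
Proof.
have m0 : (0 < m)%N by exact: ltnW.
set c := 4^-1 * _.
have c0 : 0 < c.
  by rewrite mulr_gt0 ?invr_gt0 // powR_gt0 // divr_gt0 ?pochhammer_half_gt0 //.
have string := freud_string_equation hm hlambda hbeta.
(* The value at 0 enters no walk; taking it positive makes b positive everywhere. *)
pose b n := if n is k.+1 then beta k.+1 else 1.
have bstring n : (0 < n)%N ->
    `|m.*2%:R * freud_sum b m n - n%:R| <= `|2 * lambda + 1| + `|2 * t| * b n.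
  case: n => // n _; have [bn E] := string n.
  have -> : freud_sum b m n.+1 = freud_sum beta m n.+1 by rewrite /freud_sum (eq_walk_pos _ _ _ (y := beta)).
  rewrite -E -[n.+1%:R + _ + _]addrA addrAC subrr add0r.
  apply: le_trans (ler_normD _ _) _.
  rewrite !normrM [`|beta _|]gtr0_norm // lerD2r //.
  by case: (odd n.+1); rewrite ?normr1 ?normr0 ?mulr1 ?mulr0.
have b0 n : 0 < b n by case: n => //= n; have [] := string n.
apply/cvgrPdist_lt => e e0.
have [N0 H] := recurrence_asymptotics hm (normr_ge0 (2 * t)) (normr_ge0 (2 * lambda + 1))
  b0 bstring c0 (limit_fixed R m0) e0.
exists N0.+1 => // N /= hN; rewrite distrC.
case: N hN => // N hN; apply: (H N.+1); first exact: ltnW.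
  by rewrite powR_gt0 // ltr0n.
by rewrite -powR_mulrn ?powR_ge0 // -powRrM mulVf ?powRr1 // pnatr_eq0 -lt0n.
Qed.
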